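(* Let $\ell>0$, $T>0$, $Q_T=(0,\ell)\times(0,T)$, $\overline{Q}_T=[0,\ell]\times[0,T]$ and $S_T=\{(x,0):0<x<\ell\}\cup\{(0,t):0<t<T\}$. Let $n,m\ge 1$, $0<\alpha_1<\dots<\alpha_n\le 1$, $0<\beta_1<\dots<\beta_m\le 1$, and let $p_i,q_j,r,F\in C(\overline{Q}_T)$ ($1\le i\le n$, $1\le j\le m$) be real-valued with $p_i\ge 0$ and $q_j\ge 0$ in $Q_T$ for all $i,j$, $\sum_{i=1}^n p_i(x,t)>0$ for all $(x,t)\in\overline{Q}_T$, and $r\le 0$ on $\overline{Q}_T$. Let $u_1$ and $u_2$ be real-valued functions, each satisfying (with $u=u_1$ and $u=u_2$) the regularity conditions $u\in C(\overline{Q}_T)$, $u(\cdot,t)\in W^{1,1}(0,\ell)$ for $t\in(0,T)$, $u(x,\cdot)\in W^{1,1}(0,T)$ for $x\in(0,\ell)$, and the equation $$\sum_{i=1}^n p_i(x,t)\,\partial_t^{\alpha_i}u(x,t)+\sum_{j=1}^m q_j(x,t)\,\partial_x^{\beta_j}u(x,t)=r(x,t)u(x,t)+F(x,t),\qquad (x,t)\in Q_T.$$ If $u_1=u_2$ on $S_T$, then $u_1=u_2$ on $Q_T$.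
   Context: For $0<\alpha<1$ the Caputo derivative in time is $\partial_t^{\alpha}u(x,t)=\frac{1}{\Gamma(1-\alpha)}\int_0^t(t-s)^{-\alpha}\frac{\partial}{\partial s}u(x,s)\,ds$; for $0<\beta<1$ the Caputo derivative in space is $\partial_x^{\beta}u(x,t)=\frac{1}{\Gamma(1-\beta)}\int_0^x(x-y)^{-\beta}\frac{\partial}{\partial y}u(y,t)\,dy$. For $\alpha=1$ or $\beta=1$ these are the ordinary first-order partial derivatives. $W^{1,1}(0,T)$ is the space of $g\in L^1(0,T)$ with weak derivative in $L^1(0,T)$, and similarly for $W^{1,1}(0,\ell)$. The equation is understood to hold at every point $(x,t)\in Q_T$, with all derivatives occurring in it existing there (the integrals above being absolutely convergent). *)

(* Defs.v *)
From HB Require Import structures.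
From mathcomp Require Import all_boot all_order all_algebra.
From mathcomp Require Import all_classical all_reals all_analysis.

Set Implicit Arguments.
Unset Strict Implicit.
Unset Printing Implicit Defensive.

Import Order.TTheory GRing.Theory Num.Theory.
Import numFieldNormedType.Exports.

Local Open Scope classical_set_scope.
Local Open Scope ring_scope.

Definition open_rect {R : realType} (l T : R) : set (R * R) :=
  `]0, l[%classic `*` `]0, T[%classic.

Definition closed_rect {R : realType} (l T : R) : set (R * R) :=
  `[0, l]%classic `*` `[0, T]%classic.

(* The initial edge t = 0 and the left edge x = 0, without their endpoints;
   points are pairs (x, t). *)
Definition initial_boundary {R : realType} (l T : R) : set (R * R) :=
  [set z | (0 < z.1 < l /\ z.2 = 0) \/ (z.1 = 0 /\ 0 < z.2 < T)].

Definition continuous_on {R : realType} (D : set (R * R)) (f : R * R -> R) :=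
  {within D, continuous f}.

Definition gamma {R : realType} (z : R) : R :=
  \int[@lebesgue_measure R]_(s in `]0, +oo[) (s `^ (z - 1) * expR (- s)).

Definition in_L1 {R : realType} (a b : R) (f : R -> R) :=
  (@lebesgue_measure R).-integrable `]a, b[ (EFin \o f).

Definition test_function {R : realType} (a b : R) (phi : R -> R) :=
  let supp := closure [set x | phi x != 0] in
  [/\ forall (k : nat) (x : R), derivable (derive1n k phi) x 1,
      compact supp & supp `<=` `]a, b[].

(* For f and g in L^1(a, b), so that both integrals converge. *)
Definition is_weak_derivative {R : realType} (a b : R) (f g : R -> R) :=
  forall phi : R -> R, test_function a b phi ->
    \int[@lebesgue_measure R]_(x in `]a, b[) (f x * derive1 phi x) =
    - \int[@lebesgue_measure R]_(x in `]a, b[) (g x * phi x).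

Definition W11 {R : realType} (a b : R) (f : R -> R) :=
  in_L1 a b f /\ exists g, in_L1 a b g /\ is_weak_derivative a b f g.

(* A representative of the weak derivative, which is unique up to a null set;
   meaningful only when W11 a b f holds. *)
Definition weak_derivative {R : realType} (a b : R) (f : R -> R) : R -> R :=
  xget (fun=> 0) [set g | in_L1 a b g /\ is_weak_derivative a b f g].

Definition caputo_integrand {R : realType} (L a : R) (f : R -> R) (t s : R) : R :=
  (t - s) `^ (- a) * weak_derivative 0 L f s.

(* Caputo derivative of order a, for 0 < a <= 1, at a point t of (0, L), of a
   function f in W^{1,1}(0, L), with base point 0. *)
Definition caputo {R : realType} (L a : R) (f : R -> R) (t : R) : R :=
  if a == 1 then derive1 f t
  else (gamma (1 - a))^-1 *
       \int[@lebesgue_measure R]_(s in `]0, t[) caputo_integrand L a f t s.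

Definition caputo_exists {R : realType} (L a : R) (f : R -> R) (t : R) : Prop :=
  if a == 1 then derivable f t 1
  else in_L1 0 t (caputo_integrand L a f t).

Definition caputo_t {R : realType} (T a : R) (u : R * R -> R) (z : R * R) : R :=
  caputo T a (fun s => u (z.1, s)) z.2.

Definition caputo_x {R : realType} (l b : R) (u : R * R -> R) (z : R * R) : R :=
  caputo l b (fun y => u (y, z.2)) z.1.

Definition regular {R : realType} (l T : R) (u : R * R -> R) :=
  [/\ continuous_on (closed_rect l T) u,
      forall t, 0 < t < T -> W11 0 l (fun x => u (x, t)) &
      forall x, 0 < x < l -> W11 0 T (fun t => u (x, t))].

Definition solves {R : realType} (l T : R) (n m : nat)
    (alpha : 'I_n -> R) (beta : 'I_m -> R)
    (p : 'I_n -> R * R -> R) (q : 'I_m -> R * R -> R)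
    (r F u : R * R -> R) :=
  forall z, open_rect l T z ->
    [/\ forall i, caputo_exists T (alpha i) (fun s => u (z.1, s)) z.2,
        forall j, caputo_exists l (beta j) (fun y => u (y, z.2)) z.1 &
        \sum_(i < n) p i z * caputo_t T (alpha i) u z
        + \sum_(j < m) q j z * caputo_x l (beta j) u z
        = r z * u z + F z].

(* Main.v *)
(* A weak maximum principle gives both inequalities between the solutions.  If
   [w = u1 - u2] were positive at an interior point [(a, b)], then [w - e t],
   for a small [e > 0], would have a positive maximum over [0, a] x [0, b], and
   by the initial and boundary values it is attained at an interior point of
   the domain.  Before that point [w] stays below its value there along the
   x-slice, and below it by at least [e (t - s)] along the t-slice, so the Caputo
   derivatives of [w] are nonnegative in x and positive in t, contradicting
   [r w <= 0].

   For [a < 1] the sign of the Caputo derivative is obtained without integrating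
   the singular kernel by parts.  A continuous function is the primitive of its
   weak derivative [G], so [G] has a nonnegative integral over every ]c, t[ when
   [t] is the maximum point.  The superlevel sets of the nondecreasing kernel
   [(t - s)^(-a) - t^(-a)] are such terminal segments, hence by the layer-cake
   formula its integral against [G] is nonnegative. *)

Require Import Defs.
From mathcomp Require Import all_boot all_order all_algebra.
From mathcomp Require Import all_classical all_reals all_analysis.
From mathcomp Require Import measurable_realfun ring lra.

Set Implicit Arguments.
Unset Strict Implicit.
Unset Printing Implicit Defensive.

Import Order.TTheory GRing.Theory Num.Theory.
Import numFieldNormedType.Exports.

Local Open Scope classical_set_scope.
Local Open Scope ring_scope.

(** * Smooth step functions *)

(** The recursion differentiates first and then descends, so each closure property below is an
    induction on [k] generalised over the functions, with the derivative given by an explicit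
    formula. *)
Fixpoint diffn {R : realType} (k : nat) (f : R -> R) : Prop :=
  if k is k'.+1 then (forall x : R, derivable f x 1) /\ diffn k' (derive1 f) else True.

Lemma diffn_derive1n {R : realType} (f : R -> R) :
  (forall k, diffn k f) -> forall k (x : R), derivable (derive1n k f) x 1.
Proof.
move=> fs k; have {}fs := fs k.+1; elim: k f fs => [|k IH] f [df sf] x //.
by rewrite derive1Sn; apply: IH.
Qed.

Lemma is_derive_derive1 {R : realType} (f df : R -> R) :
  (forall x : R, is_derive x 1 f (df x)) -> derive1 f = df.
Proof. by move=> H; apply/funext => x; rewrite derive1E; case: (H x). Qed.

Lemma diffnSP {R : realType} k (f df : R -> R) :
  (forall x : R, is_derive x 1 f (df x)) -> diffn k df -> diffn k.+1 f.
Proof.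
by move=> H sf /=; rewrite (is_derive_derive1 H); split=> // x; case: (H x).
Qed.

Lemma diffn_is_derive {R : realType} k (f : R -> R) :
  diffn k.+1 f -> forall x : R, is_derive x 1 f (derive1 f x).
Proof. by move=> [df _] x; rewrite derive1E; apply: derivableP. Qed.

Lemma diffnW {R : realType} k (f : R -> R) : diffn k.+1 f -> diffn k f.
Proof. by elim: k f => //= k IH f [? ?]; split=> //; apply: IH. Qed.

Lemma diffn_cst {R : realType} k (c : R) : diffn k (cst c).
Proof.
by elim: k c => // k IH c; exact: (@diffnSP _ _ _ (cst 0)).
Qed.

Lemma diffnD {R : realType} k (f g : R -> R) :
  diffn k f -> diffn k g -> diffn k (fun x => f x + g x).
Proof.
elim: k f g => // k IH f g sf sg.
refine (@diffnSP _ _ _ (fun x => derive1 f x + derive1 g x) _ _).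
  by move=> x; exact: is_deriveD (diffn_is_derive sf x) (diffn_is_derive sg x).
by apply: IH; [exact: sf.2|exact: sg.2].
Qed.

Lemma diffnM {R : realType} k (f g : R -> R) :
  diffn k f -> diffn k g -> diffn k (fun x => f x * g x).
Proof.
elim: k f g => // k IH f g sf sg.
refine (@diffnSP _ _ _ (fun x => f x * derive1 g x + g x * derive1 f x) _ _).
  by move=> x; exact: is_deriveM (diffn_is_derive sf x) (diffn_is_derive sg x).
by apply: diffnD; apply: IH; [exact: diffnW|exact: sg.2|exact: diffnW|exact: sf.2].
Qed.

Lemma diffnV {R : realType} k (f : R -> R) :
  (forall x, f x != 0) -> diffn k f -> diffn k (fun x => (f x)^-1).
Proof.
move=> f0; elim: k f f0 => // k IH f f0 sf.
refine (@diffnSP _ _ _ (fun x => (-1 * ((f x)^-1 * (f x)^-1)) * derive1 f x) _ _).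
  move=> x; have dfx := diffn_is_derive sf x.
  have := @is_deriveV R f x (derive1 f x) 1 (f0 x) dfx.
  by rewrite /= -exprVn expr2 mulN1r.
apply: diffnM; last exact: sf.2.
apply: diffnM; first exact: diffn_cst.
by apply: diffnM; apply: IH => //; apply: diffnW.
Qed.

Lemma is_derive_affine {R : realType} (f : R -> R) (df a b x : R) :
  is_derive (a * x + b) 1 f df ->
  is_derive x 1 (fun y => f (a * y + b)) (df * a).
Proof.
move=> H; apply: (@is_derive1_comp _ f (fun y => a * y + b)) => //.
rewrite -[a in X in is_derive _ _ _ X]addr0.
apply: (@is_deriveD _ _ _ (fun y => a * y) (cst b)).
by rewrite -[X in is_derive _ _ _ X]mulr1; apply: (@is_deriveZ _ _ _ id a x 1 1).
Qed.

Lemma diffn_affine {R : realType} k (f : R -> R) (a b : R) :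
  diffn k f -> diffn k (fun x => f (a * x + b)).
Proof.
elim: k f => // k IH f sf.
refine (@diffnSP _ _ _ (fun x => derive1 f (a * x + b) * a) _ _).
  by move=> x; apply: is_derive_affine; apply: diffn_is_derive; exact: sf.
apply: diffnM; last exact: diffn_cst.
by apply: IH; exact: sf.2.
Qed.

(** The polynomial factor makes this family, built on exp(-1/x), closed under differentiation, so
    smoothness is a plain induction. *)
Definition flat {R : realType} (p : {poly R}) (x : R) : R :=
  if 0 < x then p.[x^-1] * expR (- x^-1) else 0.

Lemma flat_le0 {R : realType} (p : {poly R}) (x : R) : x <= 0 -> flat p x = 0.
Proof. by move=> x0; rewrite /flat ltNge x0. Qed.

Lemma flat_gt0 {R : realType} (p : {poly R}) (x : R) :
  0 < x -> flat p x = p.[x^-1] * expR (- x^-1).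
Proof. by move=> x0; rewrite /flat x0. Qed.

(** Induction on the polynomial: in p X + c the factor y of the first term is absorbed by raising
    [n], and the constant costs y^n <= n! exp(y), read off the exponential series. *)
Lemma expR_dominates_poly {R : realType} (p : {poly R}) n :
  exists2 C : R, 0 <= C & forall y, 1 <= y -> `|p.[y]| * y ^+ n <= C * expR y.
Proof.
elim/poly_ind: p n => [|p c IH] n.
  by exists 0 => // y _; rewrite horner0 normr0 !mul0r.
have [C C0 HC] := IH n.+1.
exists (C + `|c| * n`!%:R) => [|y y1].
  by rewrite addr_ge0// mulr_ge0.
have y0 : 0 <= y by apply: le_trans y1.
rewrite hornerMXaddC (le_trans (ler_wpM2r _ (ler_normD _ _))) ?exprn_ge0//.
rewrite 2!mulrDl lerD//.
  by rewrite normrM (ger0_norm y0) -mulrA -exprS HC.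
rewrite -mulrA ler_wpM2l// mulrC -ler_pdivrMr ?ltr0n ?fact_gt0//.
case: n {HC IH C C0} => [|n].
  by rewrite expr0 fact0 divr1 (le_trans _ (expR_ge1Dx y))// lerDl.
by apply: le_trans (expR_ge1Dxn n y0); rewrite lerDr.
Qed.

(** Exponential domination at y = 1/x with exponent 2. A bound of order x^2 is what makes the
    difference quotient at 0 vanish in the limit. *)
Lemma flat_quadratic {R : realType} (p : {poly R}) :
  exists2 C : R, 0 < C & forall x, `|x| <= 1 -> `|flat p x| <= C * x ^+ 2.
Proof.
have [C C0 HC] := expR_dominates_poly p 2.
exists (C + 1) => [|x x1]; first by rewrite ltr_wpDl.
rewrite /flat; case: ifPn => x0; last first.
  by rewrite normr0 mulr_ge0 ?addr_ge0// sqr_ge0.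
have y1 : 1 <= x^-1 by rewrite invf_ge1// -(gtr0_norm x0).
have := HC _ y1.
rewrite normrM (ger0_norm (expR_ge0 _)) expRN ler_pdivrMr ?expR_gt0//.
rewrite exprVn ler_pdivrMr ?exprn_gt0// => /le_trans; apply.
by rewrite mulrAC ler_wpM2r ?expR_ge0// ler_wpM2r ?sqr_ge0// lerDl.
Qed.

(** For x > 0 the chain rule gives x^(-2) (p - p')(1/x) exp(-1/x), which is where the new polynomial
    comes from. For x < 0 the function is locally zero, and at 0 the quadratic bound applies. *)
Lemma is_derive_flat {R : realType} (p : {poly R}) (x : R) :
  is_derive x 1 (flat p) (flat ('X^2 * (p - p^`())) x).
Proof.
have [x0|x0|->] := ltgtP x 0.
- rewrite (flat_le0 _ (ltW x0)).
  apply: (@near_eq_is_derive R R R (cst 0)).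
  by near=> y; rewrite flat_le0// ltW//; near: y; exact: lt_nbhsl.
- rewrite (flat_gt0 _ x0).
  pose g (y : R) := p.[y^-1] * expR (- y^-1).
  apply: (@near_eq_is_derive _ _ _ g).
    by near=> y; rewrite flat_gt0//; near: y; exact: lt_nbhsr.
  have dV : is_derive x 1 (fun y : R => y^-1) (- x ^- 2).
    have := @is_deriveV R id x 1 1 (lt0r_neq0 x0) (is_derive_id _ _).
    by rewrite [_ *: _]mulr1.
  have d1 : is_derive x 1 (fun y : R => p.[y^-1]) (p^`().[x^-1] * (- x ^- 2)).
    exact: (@is_derive1_comp _ (horner p) (fun y : R => y^-1)).
  have dN : is_derive x 1 (fun y : R => - y^-1) (x ^- 2).
    by rewrite -[X in is_derive _ _ _ X]opprK; apply: is_deriveN.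
  have d2 : is_derive x 1 (fun y : R => expR (- y^-1)) (expR (- x^-1) * x ^- 2).
    exact: (@is_derive1_comp _ expR (fun y : R => - y^-1)).
  apply: is_derive_eq.
  rewrite !hornerE /= /GRing.scale /= exprVn; ring.
- rewrite (flat_le0 _ (lexx 0)).
  have [C C0 HC] := flat_quadratic p.
  suff L : (fun h : R => h^-1 *: (flat p (h *: 1 + 0) - flat p 0)) @ 0^' --> (0:R).
    by apply: DeriveDef; [apply/cvg_ex; exists 0|exact: cvg_lim].
  apply/cvgrPdist_le => e e0; near=> h.
  have h1 : `|h| <= 1.
    by near: h; apply: dnbhs0_le.
  have h0 : h != 0 by near: h; exact: nbhs_dnbhs_neq.
  have he : `|h| <= e / C by near: h; apply: dnbhs0_le; rewrite divr_gt0.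
  rewrite sub0r normrN addr0 /GRing.scale /= mulr1 (flat_le0 p (lexx 0)) subr0.
  rewrite normrM normfV mulrC ler_pdivrMr ?normr_gt0//.
  apply: le_trans (HC _ h1) _.
  rewrite -real_normK ?num_real// expr2 mulrA ler_wpM2r//.
  by rewrite mulrC -ler_pdivlMr.
Unshelve. all: by end_near. Qed.

Lemma diffn_flat {R : realType} k (p : {poly R}) : diffn k (flat p).
Proof.
by elim: k p => // k IH p; apply: diffnSP (is_derive_flat p) _; apply: IH.
Qed.

Definition smooth_step {R : realType} (theta : R -> R) : Prop :=
  [/\ forall k, diffn k theta, forall x, x <= 0 -> theta x = 0,
      forall x, 1 <= x -> theta x = 1 & forall x, 0 <= theta x <= 1].

(** The witness is F(x) / (F(x) + F(1 - x)) with F(x) = exp(-1/x) for x > 0 and 0 elsewhere. The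
    denominator never vanishes because x and 1 - x are not both nonpositive. *)
Lemma smooth_step_exists (R : realType) :
  exists theta : R -> R, smooth_step theta.
Proof.
pose F : R -> R := flat 1.
have F0 x : 0 <= F x.
  by rewrite /F /flat; case: ifP => // _; rewrite hornerE mul1r expR_ge0.
have Fp x : 0 < x -> 0 < F x.
  by move=> x0; rewrite /F /flat x0 hornerE mul1r expR_gt0.
have Fn x : x <= 0 -> F x = 0 by move=> x0; rewrite /F /flat ltNge x0.
pose G x := F x + F (-1 * x + 1).
have Gp x : 0 < G x.
  have [x0|x0] := ltP 0 x; first by rewrite ltr_pwDl ?Fp.
  by rewrite ltr_wpDl// Fp// mulN1r; lra.
exists (fun x => F x * (G x)^-1); split.
- move=> k; apply: diffnM; first exact: diffn_flat.
  apply: diffnV => [x|]; first by rewrite gt_eqF.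
  apply: diffnD; first exact: diffn_flat.
  exact: diffn_affine (diffn_flat _ _).
- by move=> x /Fn ->; rewrite mul0r.
- move=> x x1; rewrite /= /G (Fn (-1 * x + 1)) ?addr0 ?divff//; last lra.
  by rewrite gt_eqF// Fp//; lra.
- move=> x; rewrite divr_ge0 ?(ltW (Gp x))//= ler_pdivrMr// mul1r.
  by rewrite lerDl.
Qed.

(** * Continuous functions as primitives of their weak derivatives *)

Lemma dominated_Rintegral {R : realType} (D : set R) (f_ : nat -> R -> R)
    (f g : R -> R) :
  measurable D -> (forall n, measurable_fun D (f_ n)) ->
  (forall x, D x -> f_ ^~ x @ \oo --> f x) ->
  (@lebesgue_measure R).-integrable D (EFin \o g) ->
  (forall n x, D x -> `|f_ n x| <= g x) ->
  (fun n => \int[@lebesgue_measure R]_(x in D) f_ n x) @ \oo -->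
  \int[@lebesgue_measure R]_(x in D) f x.
Proof.
move=> mD mf_ f_f ig f_g.
have [|||||intf _ H] := @dominated_convergence _ _ R (@lebesgue_measure R) D mD
  (fun n => EFin \o f_ n) (EFin \o f) (EFin \o g).
- by move=> n; apply/measurable_EFinP; exact: mf_.
- by apply/measurable_EFinP; exact: measurable_fun_cvg f_f.
- by apply: aeW => x Dx; apply: cvg_EFin (f_f _ Dx); exact: nearW.
- exact: ig.
- by apply: aeW => x n Dx /=; rewrite lee_fin f_g.
by apply: fine_cvg; rewrite fineK; [exact: H|exact: integrable_fin_num].
Qed.

Lemma smooth_step_derive0 {R : realType} (theta : R -> R) x :
  smooth_step theta -> ~~ (0 <= x <= 1) -> derive1 theta x = 0.
Proof.
move=> [_ h0 h1 _]; rewrite negb_and -!ltNge => /orP[x0|x1]; rewrite derive1E.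
  rewrite (@near_eq_derive _ _ _ theta (cst 0)) ?derive_cst//.
  by near=> y; rewrite h0// ltW//; near: y; exact: lt_nbhsl.
rewrite (@near_eq_derive _ _ _ theta (cst 1)) ?derive_cst//.
by near=> y; rewrite h1// ltW//; near: y; exact: lt_nbhsr.
Unshelve. all: by end_near. Qed.

Lemma continuous_diffn {R : realType} (f : R -> R) : diffn 1 f -> continuous f.
Proof.
move=> df x; apply: differentiable_continuous; apply/derivable1_diffP.
exact: df.1.
Qed.

Lemma smooth_step_derive_bounded {R : realType} (theta : R -> R) :
  smooth_step theta -> exists2 C, 0 < C & forall x, `|derive1 theta x| <= C.
Proof.
move=> st; have ct : continuous (derive1 theta).
  by apply: continuous_diffn; case: st => /(_ 2) [].
have : {within `[0, 1], continuous (fun x => `|derive1 theta x|)}.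
  apply: continuous_subspaceT => x.
  by apply: continuous_comp; [exact: ct|exact: norm_continuous].
move/(EVT_max ler01) => [c _ Hc].
exists (`|derive1 theta c| + 1) => [|x]; first by rewrite ltr_wpDl.
have [x01|x01] := boolP (0 <= x <= 1); last first.
  by rewrite (smooth_step_derive0 st x01) normr0 addr_ge0.
by rewrite (le_trans (Hc x _)) ?in_itv// lerDl.
Qed.

Lemma bounded_kernel_integrable {R : realType} (D : set R) (f k : R -> R) (C : R) :
  measurable D -> (@lebesgue_measure R).-integrable D (EFin \o f) ->
  measurable_fun D k -> (forall x, D x -> `|k x| <= C) ->
  (@lebesgue_measure R).-integrable D (EFin \o (fun x => f x * k x)).
Proof.
move=> mD fi mk kC.
suff H : (@lebesgue_measure R).-integrable D ((EFin \o f) \* (EFin \o k))%E by exact: H.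
apply: integrableMl => //.
exists C; split; first exact: num_real.
by move=> y Cy x Dx; apply: le_trans (ltW Cy); exact: kC.
Qed.

Lemma is_derive_step {R : realType} (theta : R -> R) (n : nat) (c x : R) :
  smooth_step theta ->
  is_derive x 1 (fun y => theta (n%:R * y + - (n%:R * c)))
    (derive1 theta (n%:R * x + - (n%:R * c)) * n%:R).
Proof.
move=> [st _ _ _]; apply: is_derive_affine.
exact: diffn_is_derive (st 1) _.
Qed.

Lemma continuous_derive_step {R : realType} (theta : R -> R) (n : nat) (c : R) :
  smooth_step theta ->
  continuous (fun x : R => derive1 theta (n%:R * x + - (n%:R * c)) * n%:R).
Proof.
move=> [st _ _ _]; apply: continuous_diffn.
by apply: diffnM; [apply: diffn_affine; case: (st 2)|exact: diffn_cst].
Qed.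

(** The kernel is the derivative of the rescaled step, so it lives on [c, c + 1/n] and has mass 1
    for large n. As [theta] is not assumed monotone, the kernel may change sign; the error is
    controlled by its sup bound C n times the length 1/n of that interval. *)
Lemma approximate_identity {R : realType} (theta f : R -> R) (L c : R) :
  smooth_step theta -> in_L1 0 L f -> 0 < c < L -> {for c, continuous f} ->
  (fun n : nat => \int[@lebesgue_measure R]_(x in `]0, L[)
     (f x * (derive1 theta (n%:R * x + - (n%:R * c)) * n%:R))) @ \oo --> f c.
Proof.
move=> st fi /andP[c0 cL] fc; have [C C0 HC] := smooth_step_derive_bounded st.
have L0 : 0 < L by apply: lt_trans cL.
pose K (n : nat) x := derive1 theta (n%:R * x + - (n%:R * c)) * n%:R.
have Kc n : continuous (K n) by exact: continuous_derive_step.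
have mK n D : measurable D -> measurable_fun D (K n).
  by move=> mD; apply: measurable_funTS; exact: continuous_measurable_fun.
have KC n x : `|K n x| <= C * n%:R.
  by rewrite /K normrM normr_nat ler_wpM2r.
have mI : measurable (`]0, L[%classic : set R) by exact: measurable_itv.
have iK n (g : R -> R) : in_L1 0 L g -> in_L1 0 L (fun x => g x * K n x).
  by move=> gi; apply: (bounded_kernel_integrable (C := C * n%:R)) => //; exact: mK.
have icst r : in_L1 0 L (cst r).
  have muI : ((@lebesgue_measure R) `]0%R, L[%classic < +oo)%E.
    by rewrite lebesgue_measure_itv/=; case: ifP => // _; rewrite -EFinD ltry.
  have bI : [bounded (cst r : R -> R) x | x in `]0%R, L[%classic] by exact: bounded_cst.
  exact: (@measurable_bounded_integrable _ _ _ (@lebesgue_measure R) (cst r)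
    _ mI muI (measurable_cst r) bI).
have K0 n x : (0 < n)%N -> ~~ (c <= x <= c + n%:R^-1) -> K n x = 0.
  move=> n0 H; rewrite /K (smooth_step_derive0 st) ?mul0r//.
  apply: contra H; rewrite -mulrBr => /andP[h1 h2].
  rewrite -lerBlDl -[n%:R^-1]mulr1 ler_pdivlMl ?ltr0n// h2 andbT.
  by move: h1; rewrite pmulr_rge0 ?ltr0n// subr_ge0.
have mass : \forall n \near \oo, \int[@lebesgue_measure R]_(x in `]0, L[) K n x = 1.
  near=> n.
  (* From this index on c + 1/n <= L, so the step has reached 1 at [L] and the fundamental theorem
     of calculus gives mass 1. *)
  have nL : (L - c)^-1 <= n%:R by near: n; exact: nbhs_infty_ger.
  have nL1 : 1 <= n%:R * L + - (n%:R * c).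
    by rewrite -mulrBr -ler_pdivrMr ?subr_gt0// mul1r.
  pose G y := theta (n%:R * y + - (n%:R * c)).
  have dG (x : R) : is_derive x 1 G (K n x) by exact: is_derive_step.
  have cG : continuous G.
    by move=> x; apply: differentiable_continuous; apply/derivable1_diffP; case: (dG x).
  have := @continuous_FTC2 R (K n) G 0 L L0.
  rewrite /Rintegral => H.
  rewrite -(@integral_itv_bndoo R 0 L (EFin \o K n) true false); last first.
    by apply/measurable_EFinP; exact: mK.
  rewrite H /G.
  - case: st => _ h0 h1 _.
    by rewrite /= (h1 _ nL1) mulr0 add0r h0 ?subr0// oppr_le0 mulr_ge0// ltW.
  - by apply: continuous_subspaceT => x; exact: Kc.
  - split=> [x _||]; first by case: (dG x).
      by apply: cvg_at_right_filter; exact: cG.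
    by apply: cvg_at_left_filter; exact: cG.
  - by move=> x _; rewrite derive1E; case: (dG x).
apply/cvgrPdist_le => e e0.
(* The tolerance e / C on [f], multiplied by the kernel bound C n, gives the height e n of the
   majorant [B] below, whose integral over an interval of length 1/n is at most e. *)
have ec0 : 0 < e / C by rewrite divr_gt0.
have /cvgrPdist_le /(_ _ ec0) [d /= d0 Hd] := fc.
near=> n.
have n0 : (0 < n)%N by near: n; exact: nbhs_infty_gt.
have nd : n%:R^-1 < d.
  rewrite invf_plt ?posrE ?ltr0n//; near: n; exact: nbhs_infty_gtr.
have Mn : \int[@lebesgue_measure R]_(x in `]0, L[) K n x = 1 by near: n; exact: mass.
have fE : f c = \int[@lebesgue_measure R]_(x in `]0, L[) (f c * K n x).
  rewrite RintegralZl ?Mn ?mulr1//.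
  have -> : K n = (fun x => cst 1 x * K n x) by apply/funext => x; rewrite mul1r.
  exact: iK (icst 1).
rewrite [X in X - _]fE -RintegralB//; [|exact: (iK n (cst (f c)))|exact: iK].
have iB : in_L1 0 L (fun x => f c * K n x - f x * K n x).
  exact: (@integrableB _ _ _ (@lebesgue_measure R) _ mI _ _
    (iK n (cst (f c)) (icst _)) (iK n f fi)).
have := @le_normr_Rintegral _ _ _ (@lebesgue_measure R) _ _ mI iB.
move=> /le_trans; apply.
pose A : set R := `[c, c + n%:R^-1]%classic.
have mA : (@lebesgue_measure R) A = (n%:R^-1)%:E.
  rewrite lebesgue_measure_itv /= lte_fin ltrDl invr_gt0 ltr0n n0.
  by rewrite -EFinD addrC addKr.
have mmA : measurable A by exact: measurable_itv.
pose B : R -> R := cst (e * n%:R) \_ A.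
have iB' : in_L1 0 L B.
  rewrite /in_L1 /B -restrict_EFin; apply/integrable_restrict => //.
  by apply: integrableS (icst (e * n%:R)) => //; exact: measurableI.
apply: (@le_trans _ _ (\int[@lebesgue_measure R]_(x in `]0, L[) B x)).
  apply: le_Rintegral => //; first exact: integrable_norm iB.
  move=> x _; rewrite -mulrBl normrM /B patchE.
  case: ifPn => [|xA]; last first.
    rewrite K0 ?normr0 ?mulr0//; apply: contra xA => ?.
    by rewrite inE /A /= in_itv.
  rewrite inE /A /= in_itv /= => /andP[cx xc].
  rewrite [leRHS](_ : _ = e / C * (C * n%:R)); last by field; rewrite gt_eqF.
  apply: ler_pM => //; apply: Hd => /=.
  by rewrite distrC ger0_norm ?subr_ge0//; apply: le_lt_trans nd; rewrite lerBlDl.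
rewrite -Rintegral_mkcondr Rintegral_cst; last exact: measurableI.
rewrite -mulrA ler_piMr ?(ltW e0)// -ler_pdivlMl ?ltr0n// mulr1 -lee_fin.
have le : ((@lebesgue_measure R) (`]0%R, L[%classic `&` A) <= (@lebesgue_measure R) A)%E.
  by apply: le_measure; rewrite ?inE//; exact: measurableI.
rewrite fineK -?mA//; rewrite ge0_fin_numE//; apply: le_lt_trans le _.
by rewrite mA ltry.
Unshelve. all: by end_near. Qed.

(** Outside [c, t + 1/n] the two steps are both 0 or both 1, so the difference has its support in
    this segment, which the strict inequalities keep inside the open interval. *)
Lemma test_function_step {R : realType} (theta : R -> R) (L c t : R) (n : nat) :
  smooth_step theta -> 0 < c -> c < t -> (0 < n)%N -> t + n%:R^-1 < L ->
  test_function 0 L (fun x => theta (n%:R * x + - (n%:R * c)) -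
                              theta (n%:R * x + - (n%:R * t))).
Proof.
move=> st c0 ct n0 tL; set phi := (X in test_function _ _ X).
have sub : closure [set x | phi x != 0] `<=` `[c, t + n%:R^-1]%classic.
  have cl : closed `[c, t + n%:R^-1]%classic by exact: interval_closed.
  rewrite [X in _ `<=` X]((closure_id _).1 cl); apply: closure_subset => x /=.
  rewrite in_itv /= /phi; apply: contraNT => H.
  case: st => _ h0 h1 _; rewrite -!mulrBr.
  move: H; rewrite negb_and -!ltNge => /orP[xc|tx].
    by rewrite !h0 ?subrr// pmulr_rle0 ?ltr0n// subr_le0 ltW// (lt_trans xc).
  have tx' : 1 <= n%:R * (x - t).
    by rewrite -ler_pdivrMl ?ltr0n// mulr1 lerBrDl ltW.
  rewrite !h1 ?subrr// (le_trans tx')// ler_pM2l ?ltr0n// lerD2l lerN2 ltW//.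
split.
- apply: diffn_derive1n => k.
  have -> : phi = (fun x => theta (n%:R * x + - (n%:R * c)) +
                            cst (-1) x * theta (n%:R * x + - (n%:R * t))).
    by apply/funext => x; rewrite mulN1r.
  by case: st => st _ _ _; apply: diffnD; [|apply: diffnM; [exact: diffn_cst|]];
    exact: diffn_affine.
- apply: (subclosed_compact _ (@segment_compact _ c (t + n%:R^-1))) => //.
  exact: closed_closure.
- move=> x /sub; rewrite /= !in_itv /= => /andP[cx xt].
  by rewrite (lt_le_trans c0 cx) (le_lt_trans xt tL).
Qed.

(* The test functions [theta (n (x - c)) - theta (n (x - t))] tend to the
   indicator of ]c, t], and their derivatives to the difference of the Dirac
   masses at [c] and [t]. *)
Lemma weak_derivative_increment {R : realType} (L : R) (h g : R -> R) (c t : R) :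
  in_L1 0 L h -> in_L1 0 L g -> is_weak_derivative 0 L h g ->
  {in `]0, L[, continuous h} -> 0 < c -> c < t -> t < L ->
  h t - h c = \int[@lebesgue_measure R]_(x in `]c, t]) g x.
Proof.
move=> hi gi hg hc c0 ct tL; have [theta st] := smooth_step_exists R.
have mI : measurable (`]0, L[%classic : set R) by exact: measurable_itv.
have t0 : 0 < t by apply: lt_trans ct.
have cL : c < L by apply: lt_trans tL.
pose K (n : nat) (a x : R) := derive1 theta (n%:R * x + - (n%:R * a)) * n%:R.
pose phi (n : nat) (x : R) :=
  theta (n%:R * x + - (n%:R * c)) - theta (n%:R * x + - (n%:R * t)).
have dphi n (x : R) : is_derive x 1 (phi n) (K n c x - K n t x).
  by apply: is_deriveB; exact: is_derive_step.
have cphi n : continuous (phi n).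
  move=> x; apply: differentiable_continuous; apply/derivable1_diffP.
  by case: (dphi n x).
have phi1 n x : `|phi n x| <= 1.
  case: st => _ _ _ H; have := H (n%:R * x + - (n%:R * c)).
  have := H (n%:R * x + - (n%:R * t)); rewrite /phi.
  set a := theta _; set b := theta _ => ab1 ab2; rewrite ler_norml; lra.
have [C C0 HC] := smooth_step_derive_bounded st.
have iK n a : in_L1 0 L (fun x => h x * K n a x).
  apply: (bounded_kernel_integrable (C := C * n%:R)) => //.
    apply: measurable_funTS; apply: continuous_measurable_fun.
    exact: continuous_derive_step.
  by move=> x _; rewrite /K normrM normr_nat ler_wpM2r.
have mphi n : measurable_fun `]0, L[%classic (phi n).
  by apply: measurable_funTS; exact: continuous_measurable_fun.
have lhs : (fun n : nat => \int[@lebesgue_measure R]_(x in `]0, L[)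
    (h x * derive1 (phi n) x)) @ \oo --> h c - h t.
  rewrite (_ : (fun n : nat => _) = (fun n : nat =>
      \int[@lebesgue_measure R]_(x in `]0, L[) (h x * K n c x) -
      \int[@lebesgue_measure R]_(x in `]0, L[) (h x * K n t x))).
    by apply: cvgB; apply: approximate_identity => //; rewrite ?c0 ?t0 //;
      apply: hc; rewrite in_itv /= ?c0 ?t0.
  apply/funext => n; rewrite -RintegralB//; [|exact: iK..].
  apply: eq_Rintegral => x _; rewrite (is_derive_derive1 (dphi n)).
  by rewrite mulrBr.
have rhs : (fun n : nat => \int[@lebesgue_measure R]_(x in `]0, L[)
    (g x * phi n x)) @ \oo -->
    \int[@lebesgue_measure R]_(x in `]0, L[) (g \_ `]c, t]) x.
  apply: (dominated_Rintegral (g := fun x => `|g x|)) => //.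
  - move=> n; apply: measurable_funM => //.
    by apply/measurable_EFinP; exact: (measurable_int _ gi).
  - move=> x Dx; rewrite patchE.
    have lin n a : a < x -> (x - a)^-1 <= n%:R -> theta (n%:R * x + - (n%:R * a)) = 1.
      move=> ax na; case: st => _ _ h1 _; rewrite h1// -mulrBr.
      by rewrite -ler_pdivrMr ?subr_gt0// mul1r.
    have lin0 n a : x <= a -> theta (n%:R * x + - (n%:R * a)) = 0.
      move=> ax; case: st => _ h0 _ _; rewrite h0// -mulrBr.
      by rewrite mulr_ge0_le0// subr_le0.
    (* At each point the sequence is eventually constant. At x = t the second step is still 0, so
       the limit is the indicator of the interval with its right endpoint included. *)
    apply: cvg_near_cst; case: ifPn => [|xct].
      rewrite inE /= in_itv /= => /andP[cx xt].
      near=> n; rewrite /phi (lin0 _ t)// lin ?subr0 ?mulr1//.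
      by near: n; exact: nbhs_infty_ger.
    have [xc|cx] := leP x c.
      by near=> n; rewrite /phi !lin0 ?subrr ?mulr0// (le_trans xc)// ltW.
    have tx : t < x.
      by rewrite ltNge; apply: contra xct => xt; rewrite inE /= in_itv /= cx.
    near=> n; rewrite /phi !lin ?subrr ?mulr0//.
      by near: n; exact: nbhs_infty_ger.
    by near: n; exact: nbhs_infty_ger.
  - exact: (@integrable_norm _ _ _ (@lebesgue_measure R) _ _ gi).
  - by move=> n x _; rewrite normrM ler_piMr.
(* For large n the function [phi n] is a test function, so the definition of the weak derivative
   gives the same sequence a second expression for its limit. *)
have lhs' : (fun n : nat => \int[@lebesgue_measure R]_(x in `]0, L[)
    (h x * derive1 (phi n) x)) @ \oo -->
    - \int[@lebesgue_measure R]_(x in `]0, L[) (g \_ `]c, t]) x.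
  apply: cvg_trans (cvgN rhs); apply: near_eq_cvg; near=> n.
  rewrite (hg (phi n)) //; apply: test_function_step => //.
    by near: n; exact: nbhs_infty_gt.
  rewrite -ltrBrDl invf_plt ?posrE ?subr_gt0 ?ltr0n//.
    by near: n; exact: nbhs_infty_gtr.
  by near: n; exact: nbhs_infty_gt.
have := cvg_unique _ lhs lhs'.
rewrite -Rintegral_mkcondr setIidr; last first.
  move=> x /=; rewrite !in_itv /= => /andP[cx xt].
  by rewrite (lt_trans c0 cx) (le_lt_trans xt tL).
by move=> E; rewrite -[RHS]opprK -[LHS]opprB; congr (- _); exact: E.
Unshelve. all: by end_near. Qed.

(** The new case is c = 0, reached from positive left endpoints: [h] is right-continuous at 0, and
    [g] is integrable, so dominated convergence applies. Dropping the endpoint [t] changes only a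
    null set. *)
Lemma weak_derivative_primitive {R : realType} (L : R) (h g : R -> R) (c t : R) :
  in_L1 0 L h -> in_L1 0 L g -> is_weak_derivative 0 L h g ->
  {within `[0, L], continuous h} -> 0 <= c -> c < t -> t < L ->
  h t - h c = \int[@lebesgue_measure R]_(x in `]c, t[) g x.
Proof.
move=> hi gi hg hc c0 ct tL.
have t0 : 0 < t by apply: le_lt_trans ct.
have [hoo h0 _] := (continuous_within_itvP _ (lt_trans t0 tL)).1 hc.
have mI : measurable (`]0, L[%classic : set R) by exact: measurable_itv.
have sub a b : 0 <= a -> b < L -> `]a, b]%classic `<=` `]0, L[%classic.
  move=> a0 bL x /=; rewrite !in_itv /= => /andP[ax xb].
  by rewrite (le_lt_trans a0 ax) (le_lt_trans xb bL).
have gS a b : 0 <= a -> b < L ->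
    (@lebesgue_measure R).-integrable `]a, b] (EFin \o g).
  move=> a0 bL.
  by apply: (@integrableS _ _ _ (@lebesgue_measure R) _ _ _ mI _ (sub _ _ a0 bL) gi).
rewrite Rintegral_itv_bndo_bndc; last first.
  apply: (@integrableS _ _ _ (@lebesgue_measure R) _ _ _ _ _ _ (gS _ _ c0 tL)) => //.
  by move=> x /=; rewrite !in_itv /= => /andP[-> /ltW].
move: c0; rewrite le_eqVlt => /orP[/eqP c0|c0]; last first.
  exact: weak_derivative_increment hi gi hg hoo c0 ct tL.
move: ct; rewrite -{c}c0 => _.
(* The shift by 2 keeps every [c n] strictly below [t], including n = 0. *)
pose c (n : nat) := t / n.+2%:R.
have cv : c n @[n --> \oo] --> 0.
  rewrite -[0](mulr0 t); apply: cvgMr.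
  rewrite (_ : (fun n : nat => _) = (fun n => @harmonic R (n + 1)%N)).
    by rewrite (cvg_shiftn 1 (@harmonic R)); exact: cvg_harmonic.
  by apply/funext => n; rewrite /harmonic addn1.
have cn0 n : 0 < c n by rewrite /c divr_gt0.
have cnt n : c n < t by rewrite /c ltr_pdivrMr// ltr_pMr// ltr1n.
have hcv : (fun n => h t - h (c n)) @ \oo --> h t - h 0.
  apply: cvgB; first exact: cvg_cst.
  by apply: (cvg_at_rightP _ _ _).1 h0 _ _; split.
have gcv : (fun n => \int[@lebesgue_measure R]_(x in `]0, t]) (g \_ `]c n, t]) x) @ \oo
   --> \int[@lebesgue_measure R]_(x in `]0, t]) g x.
  apply: (dominated_Rintegral (g := fun x => `|g x|)) => //.
  - move=> n; apply/measurable_restrict => //.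
    apply: measurable_funS (_ : measurable_fun `]0, t]%classic g) => //.
    by apply/measurable_EFinP; exact: (measurable_int _ (gS _ _ (lexx 0) tL)).
  - move=> x; rewrite /= in_itv /= => /andP[x0 xt]; apply: cvg_near_cst.
    have : \forall n \near \oo, c n < x.
      by apply: (cvgr_lt _ cv).
    apply: filterS => n cx; rewrite patchE mem_set//.
    by rewrite /= in_itv /= cx.
  - exact: (@integrable_norm _ _ _ (@lebesgue_measure R) _ _ (gS _ _ (lexx 0) tL)).
  - by move=> n x _; rewrite patchE; case: ifPn => _ //; rewrite normr0.
apply: (cvg_unique _ hcv); first exact: Rhausdorff.
apply: cvg_trans gcv; apply: near_eq_cvg.
apply: nearW => n.
rewrite (weak_derivative_increment hi gi hg hoo (cn0 n) (cnt n) tL).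
rewrite -Rintegral_mkcondr setIidr// => x /=; rewrite !in_itv /= => /andP[cx ->].
by rewrite (lt_trans (cn0 n) cx).
Qed.

(** * Singular kernels *)

Lemma threshold_sum {R : realType} (a : R) (M : nat) : 0 <= a ->
  \sum_(j < M) (j.+1%:R <= a :> R)%:R = (minn M (Num.truncn a))%:R :> R.
Proof.
move=> a0; elim: M => [|M IH]; first by rewrite big_ord0 min0n.
rewrite big_ord_recr /= IH -natrD -truncn_ge_nat//; congr _%:R.
case: ltnP => h; first by rewrite (minn_idPl h) addn1.
by rewrite (minn_idPr (leqW h)) addn0.
Qed.

(** A discrete layer-cake formula: the sum counts the thresholds j/N below [a] for j up to N^2,
    giving min(N^2, floor(N a)) / N. The mesh is 1/N and the thresholds reach up to N, so the
    approximation is from below and is within 1/N once a <= N. *)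
Lemma threshold_approx {R : realType} (a : R) (N : nat) :
  0 <= a -> (0 < N)%N ->
  let s := (\sum_(j < N * N) (j.+1%:R <= N%:R * a :> R)%:R) / N%:R : R in
  0 <= s <= a /\ (a <= N%:R -> a - N%:R^-1 <= s).
Proof.
move=> a0 N0 s; have n0 : 0 < N%:R :> R by rewrite ltr0n.
have na0 : 0 <= N%:R * a by rewrite mulr_ge0.
rewrite /s threshold_sum//.
have /andP[h1 h2] := truncn_itv na0.
split.
  rewrite divr_ge0//= ler_pdivrMr// (mulrC a) (le_trans _ h1)// ler_nat.
  exact: geq_minr.
move=> aN; rewrite ler_pdivlMr// mulrBl mulVf ?gt_eqF// lerBlDr.
rewrite mulrC; move: h2; have [_|MN] := leqP (N * N)%N (Num.truncn (N%:R * a)).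
  move=> _; rewrite natrM (le_trans (y := N%:R * N%:R))//.
    by rewrite ler_wpM2l.
  by rewrite lerDl.
by rewrite natr1 => /ltW.
Qed.

(* The second hypothesis says that the superlevel sets of [k] are terminal
   segments; [k] is the limit of averages of their indicators. *)
Lemma nondecreasing_kernel_ge0 {R : realType} (t : R) (k G : R -> R) :
  (forall s, 0 < s < t -> 0 <= k s) ->
  (forall lam, 0 < lam -> exists2 c, 0 < c &
     forall s, 0 < s < t -> (lam <= k s) = (c <= s)) ->
  in_L1 0 t G -> in_L1 0 t (fun s => k s * G s) ->
  (forall c, 0 < c < t -> 0 <= \int[@lebesgue_measure R]_(s in `]c, t[) G s) ->
  0 <= \int[@lebesgue_measure R]_(s in `]0, t[) (k s * G s).
Proof.
move=> k0 klev iG ikG HG.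
have mI : measurable (`]0, t[%classic : set R) by exact: measurable_itv.
pose ind (lam s : R) : R := (lam <= k s :> R)%:R.
have lev lam : 0 < lam -> exists2 c, 0 < c &
    forall s, 0 < s < t -> G s * ind lam s = (G \_ `[c, t[) s.
  move=> /klev[c c0 Hc]; exists c => // s st; rewrite /ind Hc// patchE.
  rewrite mem_setE in_itv /= (andP st).2 andbT.
  by case: ifP => _; rewrite ?mulr1 ?mulr0.
have sub c : 0 < c -> `[c, t[%classic `<=` `]0, t[%classic.
  by move=> c0 x /=; rewrite !in_itv /= => /andP[cx ->]; rewrite (lt_le_trans c0 cx).
have iGS c : 0 < c -> (@lebesgue_measure R).-integrable `[c, t[ (EFin \o G).
  move=> c0.
  by apply: (@integrableS _ _ _ (@lebesgue_measure R) _ _ _ mI _ (sub _ c0) iG).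
have ilev lam : 0 < lam -> in_L1 0 t (fun s => G s * ind lam s).
  move=> /lev[c c0 Hc].
  apply: (@eq_integrable _ _ _ (@lebesgue_measure R) _ mI (EFin \o (G \_ `[c, t[))).
    by move=> s; rewrite inE /= in_itv /= => st; rewrite Hc.
  rewrite -restrict_EFin; apply/integrable_restrict => //.
  by rewrite setIidr; [exact: iGS|exact: sub].
have levge0 lam : 0 < lam ->
    0 <= \int[@lebesgue_measure R]_(s in `]0, t[) (G s * ind lam s).
  move=> /lev[c c0 Hc].
  have -> : \int[@lebesgue_measure R]_(s in `]0, t[) (G s * ind lam s) =
      \int[@lebesgue_measure R]_(s in `]0, t[) (G \_ `[c, t[) s.
    by apply: eq_Rintegral => s; rewrite inE /= in_itv /= => st; rewrite Hc.
  rewrite -Rintegral_mkcondr setIidr; last exact: sub.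
  have [ct|tc] := ltP c t; last first.
    by rewrite set_itv_ge ?Rintegral_set0// bnd_simp -leNgt.
  rewrite -Rintegral_itv_obnd_cbnd; first by apply: HG; rewrite c0.
  apply: (@integrableS _ _ _ (@lebesgue_measure R) _ _ _ _ _ _ (iGS _ c0)) => //.
  by move=> x /=; rewrite !in_itv /= => /andP[/ltW -> ->].
pose N n : nat := (n.+1 * n.+1)%N.
pose S n (s : R) : R := (\sum_(j < N n) (j.+1%:R <= n.+1%:R * k s :> R)%:R) / n.+1%:R.
(* Partial sums of the averaged indicators times [G]. Their integrability and the sign of their
   integrals are proved together by induction on [M]. *)
pose F n (M : nat) (s : R) : R :=
  \sum_(j < M) n.+1%:R^-1 * (G s * ind (j.+1%:R / n.+1%:R) s).
have SE n : (fun s => S n s * G s) = F n (N n).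
  apply/funext => s; rewrite /F -!mulr_sumr /S mulrAC mulrC (mulrC _ (G s)).
  congr (_ * (_ * _)); apply: eq_bigr => j _.
  by rewrite /ind ler_pdivrMr// mulrC.
have F0 n : F n 0%N = cst 0 by apply/funext => s; rewrite /F big_ord0.
have FS n M : F n M.+1 =
    (fun s => F n M s + n.+1%:R^-1 * (G s * ind (M.+1%:R / n.+1%:R) s)).
  by apply/funext => s; rewrite /F big_ord_recr.
have term_ge0 n M : in_L1 0 t (F n M) /\
    0 <= \int[@lebesgue_measure R]_(s in `]0, t[) F n M s.
  elim: M => [|M [IH1 IH2]].
    rewrite F0; split; first exact: (@integrable0 _ _ _ (@lebesgue_measure R)).
    exact: Rintegral_ge0.
  have lam0 : 0 < M.+1%:R / n.+1%:R :> R by rewrite divr_gt0.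
  have iM := @integrableZl _ _ _ (@lebesgue_measure R) _ mI n.+1%:R^-1 _ (ilev _ lam0).
  rewrite FS; split.
    exact: (@integrableD _ _ _ (@lebesgue_measure R) _ mI _ _ IH1 iM).
  rewrite RintegralD//; apply: addr_ge0 => //.
  rewrite RintegralZl//; last exact: ilev.
  by apply: mulr_ge0; [rewrite invr_ge0|exact: levge0].
have cv : (fun n => \int[@lebesgue_measure R]_(s in `]0, t[) (S n s * G s)) @ \oo -->
    \int[@lebesgue_measure R]_(s in `]0, t[) (k s * G s).
  (* Since 0 <= S n <= k, the integrable function |k G| dominates every term. *)
  apply: (dominated_Rintegral (g := fun s => `|k s * G s|)) => //.
  - move=> n; apply/measurable_EFinP; rewrite SE.
    exact: (measurable_int _ (term_ge0 n _).1).
  - move=> s; rewrite /= in_itv /= => st; apply: cvgMl.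
    apply/cvgrPdist_le => e e0; near=> n.
    have [/andP[h1 h2] h3] := threshold_approx (k0 _ st) (ltn0Sn n).
    rewrite ger0_norm ?subr_ge0// lerBlDl -lerBlDr.
    apply: le_trans (h3 _); first rewrite lerB//.
      by apply: ltW; near: n; exact: (near_infty_natSinv_lt (PosNum e0)).
    rewrite (@le_trans _ _ n%:R) ?ler_nat//; near: n; exact: nbhs_infty_ger.
  - exact: (@integrable_norm _ _ _ (@lebesgue_measure R) _ _ ikG).
  - move=> n s; rewrite /= in_itv /= => st.
    have [/andP[h1 h2] _] := threshold_approx (k0 _ st) (ltn0Sn n).
    rewrite normrM (normrM (k s)) ler_wpM2r// [leLHS](ger0_norm h1).
    by rewrite (ger0_norm (k0 _ st)).
apply: (cvgr_to_ge cv); apply: nearW => n.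
rewrite SE; exact: (term_ge0 n _).2.
Unshelve. all: by end_near. Qed.

Lemma ler_powRN {R : realType} (a x y : R) :
  0 < a -> 0 < x -> 0 < y -> (x `^ (- a) <= y `^ (- a)) = (y <= x).
Proof.
move=> a0 x0 y0; rewrite !powRN lef_pV2 ?posrE ?powR_gt0//.
have [yx|xy] := leP y x.
  by apply: ge0_ler_powR => //; rewrite ?nnegrE ltW.
by apply/negbTE; rewrite -ltNge; apply: gt0_ltr_powR => //; rewrite ?nnegrE ltW.
Qed.

(** The kernel minus its value at s = 0 is nonnegative with terminal superlevel sets, so the
    difference of the two sides falls under [nondecreasing_kernel_ge0]. Keeping the term with
    t^(-a), instead of bounding it by 0, later yields strict positivity in time. *)
Lemma singular_kernel_ge {R : realType} (t a : R) (G : R -> R) :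
  0 < t -> 0 < a -> in_L1 0 t G -> in_L1 0 t (fun s => (t - s) `^ (- a) * G s) ->
  (forall c, 0 < c < t -> 0 <= \int[@lebesgue_measure R]_(s in `]c, t[) G s) ->
  t `^ (- a) * \int[@lebesgue_measure R]_(s in `]0, t[) G s <=
  \int[@lebesgue_measure R]_(s in `]0, t[) ((t - s) `^ (- a) * G s).
Proof.
move=> t0 a0 iG ikG HG.
have mI : measurable (`]0, t[%classic : set R) by exact: measurable_itv.
have itG : in_L1 0 t (fun s => t `^ (- a) * G s).
  exact: (@integrableZl _ _ _ (@lebesgue_measure R) _ mI (t `^ (- a)) _ iG).
pose k s := (t - s) `^ (- a) - t `^ (- a).
have E : (fun s => k s * G s) =
    (fun s => (t - s) `^ (- a) * G s - t `^ (- a) * G s).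
  by apply/funext => s; rewrite /k mulrBl.
rewrite -subr_ge0 -RintegralZl// -RintegralB// -E.
have ts (s : R) : 0 < s < t -> 0 < t - s by move=> /andP[_]; rewrite subr_gt0.
apply: nondecreasing_kernel_ge0 => //.
- move=> s /[dup] /ts ts0 /andP[s0 st].
  by rewrite subr_ge0 ler_powRN// lerBlDr lerDl ltW.
(* Here [b] solves b^(-a) = lam + t^(-a), so the level condition becomes t - s <= b; [lam] > 0
   forces b < t. *)
- move=> lam lam0; pose b := (lam + t `^ (- a)) `^ (- a^-1).
  have l0 : 0 < lam + t `^ (- a) by rewrite addr_gt0// powR_gt0.
  have b0 : 0 < b by rewrite powR_gt0.
  have bE : b `^ (- a) = lam + t `^ (- a).
    by rewrite /b -powRrM mulrNN mulVf ?gt_eqF// powRr1// ltW.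
  exists (t - b) => [|s /ts st].
    rewrite subr_gt0 ltNge -(ler_powRN a0)// bE -ltNge.
    by rewrite ltrDr.
  by rewrite /k lerBrDr -bE ler_powRN// lerBlDr addrC -lerBlDr.
- rewrite E.
  exact: (@integrableB _ _ _ (@lebesgue_measure R) _ mI _ _ ikG itG).
Qed.

(** * Positivity of the Gamma function on ]0, 1] *)

Lemma integral_powR_near0 {R : realType} (z : R) : 0 < z ->
  (\int[@lebesgue_measure R]_(s in `]0%R, 1%R]) (s `^ (z - 1))%:E < +oo)%E.
Proof.
move=> z0.
(* Away from 0 the primitive s^z / z bounds the integrals by 1/z uniformly in n, and monotone
   convergence passes to ]0, 1]. The index [n.+2] makes each segment nondegenerate. *)
pose A (n : nat) : set R := `[n.+2%:R^-1, 1]%classic.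
have AU : `]0%R, 1%R]%classic = \bigcup_i A i :> set R.
  apply/seteqP; split=> x /=.
    rewrite in_itv /= => /andP[x0 x1].
    have [n _ Hn] := near_infty_natSinv_lt (PosNum x0).
    exists n => //; rewrite /A /= in_itv /= x1 andbT; apply: ltW.
    exact: (Hn n.+1 (leqnSn n)).
  move=> [n _]; rewrite /A /= !in_itv /= => /andP[nx ->].
  by rewrite (lt_le_trans _ nx).
have int n : (\int[@lebesgue_measure R]_(s in A n) (s `^ (z - 1))%:E <= (z^-1)%:E)%E.
  have n1 : n.+2%:R^-1 < 1 :> R by rewrite invf_lt1 ?ltr0n// ltr1n.
  have n0 : 0 < n.+2%:R^-1 :> R by rewrite invr_gt0 ltr0n.
  pose F (s : R) := z^-1 * s `^ z.
  have dF (s : R) : 0 < s -> is_derive s 1 F (s `^ (z - 1)).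
    move=> s0; have -> : s `^ (z - 1) = z^-1 *: (z * s `^ (z - 1)).
      by rewrite [_ *: _]mulKf ?gt_eqF.
    exact: (@is_deriveZ _ _ _ (fun s : R => s `^ z) z^-1 s 1 _ (is_derive1_powR _ s0)).
  have cF (s : R) : 0 < s -> {for s, continuous F}.
    move=> s0; apply: differentiable_continuous; apply/derivable1_diffP.
    by case: (dF s s0).
  rewrite /A (@continuous_FTC2 R _ F) //.
  - rewrite -EFinB lee_fin /F powR1 mulr1 lerBlDr lerDl.
    by rewrite mulr_ge0 ?powR_ge0// invr_ge0 ltW.
  - apply: continuous_in_subspaceT => s; rewrite mem_setE in_itv /= => /andP[ns _].
    apply: differentiable_continuous; apply/derivable1_diffP.
    by case: (is_derive1_powR (z - 1) (lt_le_trans n0 ns)).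
  - split=> [s||].
    + by rewrite in_itv /= => /andP[ns _]; case: (dF s (lt_trans n0 ns)).
    + by apply: cvg_at_right_filter; exact: cF.
    + by apply: cvg_at_left_filter; exact: cF.
  - move=> s; rewrite in_itv /= => /andP[ns _].
    by rewrite derive1E; case: (dF s (lt_trans n0 ns)).
rewrite AU; apply: le_lt_trans (ltry z^-1).
have mp D : measurable D -> measurable_fun D (fun s : R => (s `^ (z - 1))%:E).
  move=> mD; apply/measurable_EFinP; apply: measurable_funTS; by [].
have cv := @ge0_nondecreasing_set_cvg_integral _ (measurableTypeR R) R A
  (fun s => (s `^ (z - 1))%:E) (@lebesgue_measure R).
apply: (cvge_to_le (cv _ _ _ _)).
- apply/nondecreasing_seqP => n; rewrite subsetEset => s; rewrite /A /=.
  rewrite !in_itv /= => /andP[ns ->]; rewrite andbT (le_trans _ ns)//.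
  by rewrite lef_pV2 ?posrE// ler_nat.
- by move=> n; exact: measurable_itv.
- by move=> n; apply: mp; exact: measurable_itv.
- by move=> n s _; rewrite lee_fin powR_ge0.
- exact: nearW.
Qed.

(** The real-valued integral sends an infinite value to 0, so finiteness must be proved along with
    positivity. From below, the integrand is at least 2^(z-1) exp(-2) on [1, 2]; from above, it is
    at most s^(z-1) on ]0, 1] and exp(-s) beyond 1. *)
Lemma gamma_gt0 {R : realType} (z : R) : 0 < z -> z <= 1 -> 0 < gamma z.
Proof.
move=> z0 z1; rewrite /gamma /Rintegral; apply: fine_gt0.
pose f (s : R) := s `^ (z - 1) * expR (- s).
have f0 s : 0 <= f s by rewrite mulr_ge0 ?powR_ge0 ?expR_ge0.
have mp (D : set (measurableTypeR R)) : measurable D ->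
    measurable_fun D (fun s : R => s `^ (z - 1)).
  by move=> mD; apply: measurable_funTS.
have me (D : set (measurableTypeR R)) : measurable D ->
    measurable_fun D (fun s : R => expR (- s)).
  move=> mD; apply: measurable_funTS; apply: continuous_measurable_fun => x.
  by apply: continuous_comp; [exact: oppr_continuous|exact: continuous_expR].
have mf (D : set (measurableTypeR R)) : measurable D -> measurable_fun D (EFin \o f).
  by move=> mD; apply/measurable_EFinP; apply: measurable_funM; [exact: mp|exact: me].
have ef0 s : (0 <= (f s)%:E)%E by rewrite lee_fin.
apply/andP; split.
  have c0 : 0 < 2 `^ (z - 1) * expR (- 2) :> R by rewrite mulr_gt0 ?powR_gt0 ?expR_gt0.
  apply: (@lt_le_trans _ _
      (\int[@lebesgue_measure R]_(s in `[1%R, 2%R]) (2 `^ (z - 1) * expR (- 2))%:E)%E).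
    rewrite integral_cst//= lebesgue_measure_itv /= lte_fin ltr1n -EFinD.
    by rewrite -EFinM lte_fin mulr_gt0// subr_gt0 ltr1n.
  apply: (@le_trans _ _ (\int[@lebesgue_measure R]_(s in `[1%R, 2%R]) (f s)%:E)%E).
    apply: ge0_le_integral => //.
    - exact: mf.
    - move=> s; rewrite /= in_itv /= => /andP[s1 s2].
      have s0 : 0 < s by apply: lt_le_trans s1.
      rewrite lee_fin ler_pM ?powR_ge0 ?expR_ge0// ?ler_expR ?lerN2//.
      have [->|zn1] := eqVneq z 1; first by rewrite subrr !powRr0.
      have a0 : 0 < 1 - z by rewrite subr_gt0 lt_neqAle zn1.
      by rewrite -[z - 1]opprK opprB ler_powRN.
  apply: ge0_subset_integral => //; first exact: mf.
  by move=> s /=; rewrite !in_itv /= => /andP[s1 _]; rewrite (lt_le_trans _ s1).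
have -> : `]0, +oo[%classic = `]0, 1]%classic `|` `]1, +oo[%classic :> set R.
  apply/seteqP; split=> s /=; rewrite !in_itv /= !andbT.
    by move=> s0; have [s1|s1] := leP s 1; [left; rewrite s0|right].
  by move=> [/andP[]//|]; apply: lt_trans.
rewrite ge0_integral_setU//; last 3 first.
- by apply: (mf _); exact: measurableU.
- by move=> s _; exact: ef0.
- apply/disj_setPS => s /= [].
  by rewrite !in_itv /= andbT => /andP[_ s1]; rewrite ltNge s1.
apply: lte_add_pinfty.
  apply: le_lt_trans (integral_powR_near0 z0).
  apply: ge0_le_integral => //.
  - by move=> s _; exact: ef0.
  - exact: mf.
  - by apply/measurable_EFinP; exact: mp.
  - move=> s; rewrite /= in_itv /= => /andP[s0 _].
    by rewrite lee_fin ler_piMr ?powR_ge0// expR_le1 oppr_le0 ltW.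
apply: (@le_lt_trans _ _
    (\int[@lebesgue_measure R]_(s in `[0%R, +oo[) (expR (- s))%:E)%E).
  apply: (@le_trans _ _ (\int[@lebesgue_measure R]_(s in `]1%R, +oo[) (expR (- s))%:E)%E).
    apply: ge0_le_integral => //.
    - by move=> s _; exact: ef0.
    - exact: mf.
    - by apply/measurable_EFinP; exact: me.
    - move=> s; rewrite /= in_itv /= andbT => s1.
      rewrite lee_fin ler_piMl ?expR_ge0//.
      have := @ler_powR R s (ltW s1) (z - 1) 0; rewrite powRr0; apply.
      by rewrite subr_le0.
  apply: ge0_subset_integral => //.
  - by apply/measurable_EFinP; exact: me.
  - by move=> s /=; rewrite !in_itv /= !andbT => /ltW; apply: le_trans.
have dN (s : R) : is_derive s 1 (fun x : R => - expR (- x)) (expR (- s)).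
  have -> : expR (- s) = - (expR (- s) * -1) by rewrite mulrN1 opprK.
  apply: is_deriveN; exact: (@is_derive1_comp _ expR -%R).
have cN : continuous (fun x : R => - expR (- x)).
  by move=> s; apply: differentiable_continuous; apply/derivable1_diffP; case: (dN s).
rewrite (@ge0_continuous_FTC2y R _ (fun x => - expR (- x)) 0 0).
- by rewrite oppr0 expR0 -EFinB ltry.
- by move=> s _; rewrite expR_ge0.
- apply: continuous_subspaceT => s.
  by apply: continuous_comp; [exact: oppr_continuous|exact: continuous_expR].
- by have := cvgN (@cvgr_expR R); rewrite oppr0; apply.
- by move=> s _; case: (dN s).
- by apply: cvg_at_right_filter; exact: cN.
- by move=> s _; rewrite derive1E; case: (dN s).
Qed.

(** * The extremum principle *)

(** For h < 0 the hypothesis at s = t + h bounds the difference quotient below by [e], and the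
    derivative is its limit from the left. *)
Lemma derive1_left_slope {R : realType} (w : R -> R) (t e : R) :
  derivable w t 1 -> 0 < t ->
  (forall s, 0 <= s <= t -> w s + e * (t - s) <= w t) -> e <= derive1 w t.
Proof.
move=> dw t0 H.
have cv : (fun h : R => h^-1 *: (w (h *: 1 + t) - w t)) @ 0^'- --> derive1 w t.
  by rewrite derive1E; apply: cvg_dnbhs_at_left; exact: dw.
apply: (cvgr_to_ge cv); near=> h.
have h0 : h < 0 by near: h; exact: nbhs_left_lt.
have ht : - t <= h by near: h; apply: nbhs_left_ge; rewrite oppr_lt0.
rewrite /= [_%:A]mulr1 -[e](mulKf (ltr0_neq0 h0)) [_ *: _]/(_ * _).
rewrite ler_nM2l ?invr_lt0//.
have ht0 : 0 <= h + t <= t by apply/andP; split; lra.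
by have := H _ ht0; lra.
Unshelve. all: by end_near. Qed.

Lemma weak_derivativeP {R : realType} (a b : R) (f : R -> R) : W11 a b f ->
  in_L1 a b (weak_derivative a b f) /\
  is_weak_derivative a b f (weak_derivative a b f).
Proof. by move=> [_ exg]; exact: (xgetPex (fun=> 0) exg). Qed.

(** One bound serves both variables: e > 0 gives strict positivity in time, e = 0 gives
    nonnegativity in space. It concerns a difference of Caputo derivatives because [weak_derivative]
    chooses a representative for each function, so linearity holds only up to null sets. *)
Lemma caputo_sub_lower_bound {R : realType} (L a t : R) (f1 f2 : R -> R) :
  0 < t < L -> 0 < a <= 1 -> W11 0 L f1 -> W11 0 L f2 ->
  {within `[0, L], continuous f1} -> {within `[0, L], continuous f2} ->
  caputo_exists L a f1 t -> caputo_exists L a f2 t ->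
  exists2 C : R, 0 < C & forall e, 0 <= e ->
    (forall s, 0 <= s <= t -> f1 s - f2 s + e * (t - s) <= f1 t - f2 t) ->
    C * e <= caputo L a f1 t - caputo L a f2 t.
Proof.
move=> /andP[t0 tL] /andP[a0 a1] W1 W2 c1 c2; rewrite /caputo_exists /caputo.
have [_|an1] := eqVneq a 1.
  move=> d1 d2; exists 1; first exact: ltr01.
  move=> e _ H; rewrite mul1r !derive1E -(deriveB d1 d2) -derive1E.
  exact: derive1_left_slope (derivableB d1 d2) t0 H.
move=> i1 i2.
have {a1 an1} a1 : a < 1 by rewrite lt_neqAle an1.
have G0 : 0 < (gamma (1 - a))^-1.
  by rewrite invr_gt0; apply: gamma_gt0; [rewrite subr_gt0|rewrite lerBlDr lerDl ltW].
(* The constant is t^(1-a) / Gamma(1-a): the kernel at s = 0 is t^(-a), and the total increment over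
   ]0, t[ is at least e t. *)
exists ((gamma (1 - a))^-1 * (t `^ (- a) * t)) => [|e e0 H].
  by rewrite !mulr_gt0// powR_gt0.
rewrite -mulrBr -mulrA ler_pM2l//.
have mt : measurable (`]0, t[%classic : set R) by exact: measurable_itv.
have mL : measurable (`]0, L[%classic : set R) by exact: measurable_itv.
have [ig1 wg1] := weak_derivativeP W1; have [ig2 wg2] := weak_derivativeP W2.
have tS c g : 0 <= c -> in_L1 0 L g ->
    (@lebesgue_measure R).-integrable `]c, t[ (EFin \o g).
  move=> c0 ig; apply: (@integrableS _ _ _ (@lebesgue_measure R) _ _ _ mL _ _ ig) => //.
  move=> s /=; rewrite !in_itv /= => /andP[cs st].
  by rewrite (le_lt_trans c0 cs) (lt_trans st).
pose G s := weak_derivative 0 L f1 s - weak_derivative 0 L f2 s.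
have GE c : 0 <= c -> c < t -> \int[@lebesgue_measure R]_(s in `]c, t[) G s =
    (f1 t - f2 t) - (f1 c - f2 c).
  move=> c0 ct; rewrite /G RintegralB//; [|exact: tS..].
  rewrite -(weak_derivative_primitive W1.1 ig1 wg1)//.
  by rewrite -(weak_derivative_primitive W2.1 ig2 wg2)//; ring.
rewrite -RintegralB//.
have E : (fun s => caputo_integrand L a f1 t s - caputo_integrand L a f2 t s) =
    (fun s => (t - s) `^ (- a) * G s).
  by apply/funext => s; rewrite /caputo_integrand -mulrBr.
rewrite E; apply: le_trans (singular_kernel_ge t0 a0 _ _ _).
- rewrite GE// -mulrA ler_wpM2l ?powR_ge0//.
  by have := H 0; rewrite lexx subr0 (ltW t0) => /(_ isT); rewrite addrC -lerBrDr mulrC.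
- exact: (@integrableB _ _ _ (@lebesgue_measure R) _ mt _ _
    (tS _ _ (lexx 0) ig1) (tS _ _ (lexx 0) ig2)).
- rewrite -E; exact: (@integrableB _ _ _ (@lebesgue_measure R) _ mt _ _ i1 i2).
(* The integral of [G] over ]c, t[ is an increment of f1 - f2, nonnegative because its value at [t]
   is maximal. *)
- move=> c /andP[c0 ct]; rewrite GE ?(ltW c0)// subr_ge0.
  apply: le_trans (H c _); last by rewrite !ltW.
  by rewrite lerDl mulr_ge0// subr_ge0 ltW.
Qed.

(** * Comparison of solutions on the rectangle *)

Lemma continuous_on_comp {R : realType} (f : R * R -> R) (D : set (R * R))
    (g : R -> R * R) (A : set R) :
  continuous_on D f -> continuous g -> (forall x, A x -> D (g x)) ->
  {within A, continuous (f \o g)}.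
Proof.
move=> /subspace_continuousP fD cg AD; apply/subspace_continuousP => x Ax.
apply: (@cvg_comp _ _ _ g f _ _ _ _ (fD _ (AD _ Ax))) => P.
move=> DP; suff : nbhs x [set y | A y -> P (g y)] by [].
have := cg x [set z | D z -> P z] DP.
apply: (@filterS _ (nbhs x)) => y h Ay; exact: h (AD _ Ay).
Qed.

Lemma continuous_on_slice_x {R : realType} (l T t : R) (u : R * R -> R) :
  continuous_on (closed_rect l T) u -> 0 <= t <= T ->
  {within `[0, l], continuous (fun x => u (x, t))}.
Proof.
move=> cu tT; apply: (continuous_on_comp (g := fun x => (x, t)) cu).
  move=> x.
  exact: (@cvg_pair _ _ _ _ (nbhs x) (nbhs t) _ _ _ id (cst t) cvg_id (cvg_cst _)).
by move=> x; rewrite /= in_itv /= => xl; split; rewrite /= in_itv.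
Qed.

Lemma continuous_on_slice_t {R : realType} (l T x : R) (u : R * R -> R) :
  continuous_on (closed_rect l T) u -> 0 <= x <= l ->
  {within `[0, T], continuous (fun t => u (x, t))}.
Proof.
move=> cu xl; apply: (continuous_on_comp (g := fun t => (x, t)) cu).
  move=> t.
  exact: (@cvg_pair _ _ _ _ (nbhs x) (nbhs t) _ _ _ (cst x) id (cvg_cst _) cvg_id).
by move=> t; rewrite /= in_itv /= => tT; split; rewrite /= in_itv.
Qed.

(** The set [initial_boundary] omits the corner, where a maximum could sit; the values there agree
    by continuity along the edge t = 0. *)
Lemma initial_boundary_corner {R : realType} (l T : R) (u1 u2 : R * R -> R) :
  0 < l -> 0 < T -> continuous_on (closed_rect l T) u1 ->
  continuous_on (closed_rect l T) u2 ->
  (forall z, initial_boundary l T z -> u1 z = u2 z) -> u1 (0, 0) = u2 (0, 0).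
Proof.
move=> l0 T0 c1 c2 H.
have T00 : 0 <= (0 : R) <= T by rewrite lexx ltW.
have /(continuous_within_itvP _ l0)[_ h1 _] := continuous_on_slice_x c1 T00.
have /(continuous_within_itvP _ l0)[_ h2 _] := continuous_on_slice_x c2 T00.
apply: (@cvg_unique _ (@Rhausdorff R) _ _ _ _ h1).
apply: cvg_trans h2; apply: near_eq_cvg; near=> x; apply/esym; apply: H; left.
split=> //=; apply/andP; split; near: x; first exact: nbhs_right_gt.
exact: nbhs_right_lt.
Unshelve. all: by end_near. Qed.

Lemma solves_comparison {R : realType} (l T : R) (n m : nat)
    (alpha : 'I_n -> R) (beta : 'I_m -> R)
    (p : 'I_n -> R * R -> R) (q : 'I_m -> R * R -> R)
    (r F u1 u2 : R * R -> R) :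
  0 < l -> 0 < T ->
  (forall i, 0 < alpha i <= 1) -> (forall j, 0 < beta j <= 1) ->
  (forall i z, open_rect l T z -> 0 <= p i z) ->
  (forall j z, open_rect l T z -> 0 <= q j z) ->
  (forall z, open_rect l T z -> 0 < \sum_(i < n) p i z) ->
  (forall z, open_rect l T z -> r z <= 0) ->
  regular l T u1 -> regular l T u2 ->
  solves l T alpha beta p q r F u1 -> solves l T alpha beta p q r F u2 ->
  (forall z, initial_boundary l T z -> u1 z = u2 z) ->
  forall z, open_rect l T z -> u1 z <= u2 z.
Proof.
move=> l0 T0 al be p0 q0 ps r0 [c1 x1 t1] [c2 x2 t2] s1 s2 H [a b] [/=].
rewrite !in_itv /= => /andP[a0 al'] /andP[b0 bT].
rewrite leNgt; apply/negP => uab; rewrite -subr_gt0 in uab.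
have corner := initial_boundary_corner l0 T0 c1 c2 H.
(* This slope makes [v] at (a, b) exactly half of u1 - u2 there, hence positive. *)
pose e := (u1 (a, b) - u2 (a, b)) / (2 * b).
have e0 : 0 < e by rewrite divr_gt0// mulr_gt0.
pose v (z : R * R) := u1 z - u2 z - e * z.2.
(* Since a < l and b < T, a maximum on the right or top edge of [K] is still interior to the domain,
   where the equation holds. *)
pose K : set (R * R) := `[0, a]%classic `*` `[0, b]%classic.
have KD : K `<=` closed_rect l T.
  move=> z [] /=; rewrite !in_itv /= => /andP[h1 h2] /andP[h3 h4].
  by split; rewrite /= in_itv /= ?h1 ?h3; [exact: ltW (le_lt_trans h2 al')|
    exact: ltW (le_lt_trans h4 bT)].
have cK : compact K by apply: compact_setX; exact: segment_compact.
have Kab : K (a, b) by split; rewrite /= in_itv /= lexx ltW.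
have cv : {within K, continuous v}.
  move=> z; apply: cvgB; last first.
    apply: cvgMr; apply: continuous_subspaceT => y; exact: cvg_snd.
  by apply: cvgB; apply: continuous_subspaceW KD _ _.
have [[a' b'] + Hmax] := @compact_EVT_max _ R v K (ex_intro _ _ Kab) cK cv.
rewrite inE => -[/=]; rewrite !in_itv /= => /andP[a'0 a'a] /andP[b'0 b'b].
have vpos : 0 < v (a', b').
  apply: lt_le_trans (Hmax (a, b) _); last by rewrite inE.
  rewrite /v /= (_ : _ - _ = (u1 (a, b) - u2 (a, b)) / 2) ?divr_gt0//.
  by rewrite /e; field; rewrite gt_eqF.
have a'l : a' < l by apply: le_lt_trans al'.
have b'T : b' < T by apply: le_lt_trans bT.
have wpos : 0 < u1 (a', b') - u2 (a', b').
  by move: vpos; rewrite /v /= subr_gt0; apply: le_lt_trans; rewrite mulr_ge0// ltW.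
have {}a'0 : 0 < a'.
  rewrite lt_neqAle a'0 andbT; apply/eqP => a'E; move: wpos; rewrite -a'E.
  move: b'0; rewrite le_eqVlt => /orP[/eqP <-|b'0]; first by rewrite corner subrr ltxx.
  by rewrite H ?subrr ?ltxx//; right; rewrite /= b'0.
have {}b'0 : 0 < b'.
  rewrite lt_neqAle b'0 andbT; apply/eqP => b'E; move: wpos; rewrite -b'E.
  by rewrite H ?subrr ?ltxx//; left; rewrite /= a'0.
have Oz : open_rect l T (a', b').
  by split; rewrite /= in_itv /= ?a'0 ?b'0.
have b'T' : 0 <= b' <= T by rewrite !ltW.
have a'l' : 0 <= a' <= l by rewrite !ltW.
have b'T2 : 0 < b' < T by rewrite b'0.
have a'l2 : 0 < a' < l by rewrite a'0.
have [ct1 cx1 eq1] := s1 _ Oz; have [ct2 cx2 eq2] := s2 _ Oz.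
have dt i : 0 < caputo_t T (alpha i) u1 (a', b') - caputo_t T (alpha i) u2 (a', b').
  have [C C0 HC] := caputo_sub_lower_bound b'T2 (al i) (t1 _ a'l2) (t2 _ a'l2)
    (continuous_on_slice_t c1 a'l') (continuous_on_slice_t c2 a'l') (ct1 i) (ct2 i).
  apply: lt_le_trans (HC e (ltW e0) _); first exact: mulr_gt0.
  move=> s /andP[s0 sb'].
  have : v (a', s) <= v (a', b').
    apply: Hmax; rewrite inE; split; rewrite /= in_itv /= ?s0 ?(ltW a'0)//.
    exact: le_trans b'b.
  rewrite /v /= => le_v.
  (* Maximality of [v] along the t-slice, with the penalty moved to the left side, is the hypothesis
     of the lower bound with slope [e]. *)
  by rewrite mulrBr (addrC (e * b')) addrA -lerBrDr.
have dx j : 0 <= caputo_x l (beta j) u1 (a', b') - caputo_x l (beta j) u2 (a', b').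
  have [C C0 HC] := caputo_sub_lower_bound a'l2 (be j) (x1 _ b'T2) (x2 _ b'T2)
    (continuous_on_slice_x c1 b'T') (continuous_on_slice_x c2 b'T') (cx1 j) (cx2 j).
  (* Along the x-slice the penalty is constant and cancels, so the bound is used with slope 0. *)
  rewrite -[leLHS](mulr0 C); apply: HC => // s /andP[s0 sa'].
  have : v (s, b') <= v (a', b').
    apply: Hmax; rewrite inE; split; rewrite /= in_itv /= ?s0 ?(ltW b'0)//.
    exact: le_trans a'a.
  by rewrite /v /= lerD2r mul0r addr0.
have sub : \sum_(i < n) p i (a', b') *
      (caputo_t T (alpha i) u1 (a', b') - caputo_t T (alpha i) u2 (a', b')) +
    \sum_(j < m) q j (a', b') *
      (caputo_x l (beta j) u1 (a', b') - caputo_x l (beta j) u2 (a', b')) =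
    r (a', b') * (u1 (a', b') - u2 (a', b')).
  under eq_bigr do rewrite mulrBr.
  under [X in _ + X]eq_bigr do rewrite mulrBr.
  have lin (A A' B B' c x y g : R) : A + B = c * x + g -> A' + B' = c * y + g ->
      A - A' + (B - B') = c * (x - y) by clear; lra.
  by rewrite !sumrB; exact: lin eq1 eq2.
have : r (a', b') * (u1 (a', b') - u2 (a', b')) <= 0.
  by rewrite mulr_le0_ge0 ?r0// ltW.
rewrite -sub leNgt => /negP; apply.
apply: ltr_pwDl; last first.
  by apply: sumr_ge0 => j _; exact: mulr_ge0 (q0 j _ Oz) (dx j).
rewrite lt_neqAle eq_sym; apply/andP; split; last first.
  by apply: sumr_ge0 => i _; exact: mulr_ge0 (p0 i _ Oz) (ltW (dt i)).
(* If the time sum vanished, each of its nonnegative terms would; the derivative factors are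
   positive, so every [p i] would be 0 at this point, against the positivity of their sum. *)
apply/negP => /eqP /psumr_eq0P Hs.
have := ps _ Oz; rewrite big1 ?ltxx// => i _.
have /eqP := Hs (fun i _ => mulr_ge0 (p0 i _ Oz) (ltW (dt i))) i isT.
by rewrite mulf_eq0 (gt_eqF (dt i)) orbF => /eqP.
Qed.

Theorem corollary3p3 (R : realType) (l T : R) (n m : nat)
    (alpha : 'I_n -> R) (beta : 'I_m -> R)
    (p : 'I_n -> R * R -> R) (q : 'I_m -> R * R -> R)
    (r F u1 u2 : R * R -> R)
    (l_gt0 : 0 < l) (T_gt0 : 0 < T)
    (n_ge1 : (1 <= n)%N) (m_ge1 : (1 <= m)%N)
    (alpha_range : forall i : 'I_n, 0 < alpha i <= 1)
    (alpha_incr : forall i j : 'I_n, (i < j)%N -> alpha i < alpha j)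
    (beta_range : forall j : 'I_m, 0 < beta j <= 1)
    (beta_incr : forall i j : 'I_m, (i < j)%N -> beta i < beta j)
    (p_cont : forall i, continuous_on (closed_rect l T) (p i))
    (q_cont : forall j, continuous_on (closed_rect l T) (q j))
    (r_cont : continuous_on (closed_rect l T) r)
    (F_cont : continuous_on (closed_rect l T) F)
    (p_ge0 : forall i z, open_rect l T z -> 0 <= p i z)
    (q_ge0 : forall j z, open_rect l T z -> 0 <= q j z)
    (p_sum_gt0 : forall z, closed_rect l T z -> 0 < \sum_(i < n) p i z)
    (r_le0 : forall z, closed_rect l T z -> r z <= 0)
    (u1_regular : regular l T u1) (u2_regular : regular l T u2)
    (u1_solves : solves l T alpha beta p q r F u1)
    (u2_solves : solves l T alpha beta p q r F u2)
    (u_eq : forall z, initial_boundary l T z -> u1 z = u2 z) :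
  forall z, open_rect l T z -> u1 z = u2 z.
Proof.
have OC z : open_rect l T z -> closed_rect l T z.
  by move=> [/=]; rewrite !in_itv /= => /andP[? ?] /andP[? ?]; split;
    rewrite /= in_itv /= !ltW.
have ps z : open_rect l T z -> 0 < \sum_(i < n) p i z by move=> /OC/p_sum_gt0.
have rs z : open_rect l T z -> r z <= 0 by move=> /OC/r_le0.
move=> z Oz; apply/eqP; rewrite eq_le; apply/andP; split.
  exact: (solves_comparison l_gt0 T_gt0 alpha_range beta_range p_ge0 q_ge0 ps rs
    u1_regular u2_regular u1_solves u2_solves u_eq Oz).
have u_eq' z' : initial_boundary l T z' -> u2 z' = u1 z' by move=> /u_eq.
exact: (solves_comparison l_gt0 T_gt0 alpha_range beta_range p_ge0 q_ge0 ps rs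
  u2_regular u1_regular u2_solves u1_solves u_eq' Oz).
Qed.
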